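(* Let $X=\{X_t,\ t\in\mathbb{N}_0\}$ be a discrete-time process with values in a countable set $E$, and let $\gamma=\{\gamma_t,\ t\in\mathbb{N}_0\}$ be its sojourn time process. Then the following properties are equivalent: (1) $X$ is a (discrete-time) semi-Markov process; (2) $(X,\gamma)=\{(X_t,\gamma_t),\ t\in\mathbb{N}_0\}$ is a Markov process.
   Context: $\mathbb{N}$ denotes the positive integers and $\mathbb{N}_0=\mathbb{N}\cup\{0\}$. A filtered probability space $(\Omega,\mathcal{F},(\mathcal{F}_t)_{t\in\mathbb{N}_0},\mathbb{P})$ is fixed. The sojourn time process (or age process) of $X$ is $$\gamma_t=\max\{i\le t:\ \forall j\le i,\ X_t=X_{t-j}\},\qquad t\in\mathbb{N}_0 .$$ $X$ is called a (discrete-time) semi-Markov process if it exhibits the strong Markov property on any Markov time $\tau$ with values in the random set $M=\{t\in\mathbb{N}:\ X_{t-1}\neq X_t\}\cup\{0\}$. Here a Markov time $\tau$ with values in $M$ is one such that $\mathbb{P}(\tau\in M)=1$, and the strong Markov property on $\tau$ means that, for $n\in\mathbb{N}$ and $x\in E$, the conditional probability of $\{X_{\tau+n}=x\}$ given $X_\tau,X_{\tau-1},\dots,X_0$ equals its conditional probability given $X_\tau$. The process $(X,\gamma)$ is Markov if, for every $n\in\mathbb{N}$, the conditional probability of $\{(X_n,\gamma_n)=(x_n,t_n)\}$ given $(X_{n-1},\gamma_{n-1})=(x_{n-1},t_{n-1}),\dots,(X_0,\gamma_0)=(x_0,t_0)$ equals the conditional probability given $(X_{n-1},\gamma_{n-1})=(x_{n-1},t_{n-1})$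 only (whenever the conditioning event has positive probability).
   Formalization: The filtration is taken to be the natural one of X; the Markov time τ may be infinite (τ∈M a.s. on {τ<∞}); and both conditional probabilities in the strong Markov property are also conditioned on the value of τ. As literally worded the equivalence fails. *)

(* Defs.v *)
From HB Require Import structures.
From mathcomp Require Import all_boot all_order all_algebra.
From mathcomp Require Import all_classical all_reals all_analysis.

Set Implicit Arguments.
Unset Strict Implicit.
Unset Printing Implicit Defensive.

Import Order.TTheory GRing.Theory Num.Theory.

Local Open Scope classical_set_scope.
Local Open Scope ring_scope.

(* A discrete-time process with values in the countable set [E], which carries
   the discrete sigma-algebra. *)
Definition discrete_process d (T : measurableType d) (E : countType)
    (X : nat -> T -> E) : Prop :=
  forall (t : nat) (A : set E), measurable (X t @^-1` A).

Definition natural_filtration (T : Type) (E : Type) (X : nat -> T -> E)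
    (t : nat) : set (set T) :=
  <<s [set B | exists s (A : set E), (s <= t)%N /\ B = X s @^-1` A] >>.

Definition sojourn (T : Type) (E : eqType) (X : nat -> T -> E)
    (t : nat) (w : T) : nat :=
  (\max_(i < t.+1 | [forall j : 'I_i.+1, X t w == X (t - j)%N w]) i)%N.

Definition renewal_set (T : Type) (E : Type) (X : nat -> T -> E)
    (w : T) : set nat :=
  [set t | t = 0%N \/ (0 < t)%N /\ X t.-1 w <> X t w].

(* Only used below when [P B] is positive. *)
Definition cond_prob d (T : measurableType d) (R : realType)
    (P : probability T R) (A B : set T) : R :=
  fine (P (A `&` B)) / fine (P B).

(* A random time is [option nat]-valued, [None] being the value +oo. *)
Definition markov_time (T : Type) (F : nat -> set (set T))
    (tau : T -> option nat) : Prop :=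
  forall t : nat, F t [set w | exists2 s, tau w = Some s & (s <= t)%N].

(* As usual for Markov times, tau may be infinite, so the requirement is that
   tau lies in M almost surely on {tau < +oo}. Were tau required to be almost
   surely finite, a process that may be absorbed after any finite path would
   have no nonzero such time, and the semi-Markov property would be void. *)
Definition valued_in d (T : measurableType d) (R : realType)
    (P : probability T R) (tau : T -> option nat) (M : T -> set nat) : Prop :=
  P [set w | forall t, tau w = Some t -> M w t] = 1%:E.

(* The event {X_(tau + n) = x}, included in {tau < +oo}. *)
Definition shifted_event (T E : Type) (X : nat -> T -> E)
    (tau : T -> option nat) (n : nat) (x : E) : set T :=
  [set w | exists2 t, tau w = Some t & X (t + n)%N w = x].

(* P(X_(tau+n) = x | X_tau, ..., X_0) = P(X_(tau+n) = x | X_tau), on every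
   event {tau = t}. The length of the path X_0, ..., X_tau reveals tau, and X
   is not assumed to be time-homogeneous, so both sides are taken at tau = t. *)
Definition strong_markov_at d (T : measurableType d) (R : realType)
    (P : probability T R) (E : Type) (X : nat -> T -> E)
    (tau : T -> option nat) : Prop :=
  forall (n : nat) (x : E) (t : nat) (y : nat -> E), (0 < n)%N ->
  let past :=
    [set w | tau w = Some t /\ forall k, (k <= t)%N -> X k w = y k] in
  let present := [set w | tau w = Some t /\ X t w = y t] in
  (0 < P past)%E ->
  cond_prob P (shifted_event X tau n x) past =
  cond_prob P (shifted_event X tau n x) present.

Definition semi_markov d (T : measurableType d) (R : realType)
    (P : probability T R) (F : nat -> set (set T)) (E : Type)
    (X : nat -> T -> E) : Prop :=
  forall tau : T -> option nat,
    markov_time F tau -> valued_in P tau (renewal_set X) ->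
    strong_markov_at P X tau.

Definition markov_process d (T : measurableType d) (R : realType)
    (P : probability T R) (S : Type) (Y : nat -> T -> S) : Prop :=
  forall (n : nat) (y : nat -> S), (0 < n)%N ->
  let past := [set w | forall k, (k < n)%N -> Y k w = y k] in
  let present := [set w | Y n.-1 w = y n.-1] in
  (0 < P past)%E ->
  cond_prob P [set w | Y n w = y n] past =
  cond_prob P [set w | Y n w = y n] present.

(* Main.v *)
(** Independence of the event [A] from [X 0, ..., X t], given an event [G] of
    the past, is stable under chaining, countable disjoint unions and differences.
    Property (1) says that it holds for [A = {X (s + n) = z}] given that [s] is
    a renewal time and [X s = x]; property (2) that it holds for an event of the
    state [(X, gamma)] at time [t.+1] given the state at time [t].

    (2) implies (1): chaining the one-step property gives the [n]-step property,
    and [s] is a renewal time exactly when [gamma s = 0].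

    (1) implies (2): the event [(X, gamma) (s + g) = (x, g)] says that [s] is a
    renewal time and that [X] stays at [x] up to [s + g]. Since (1) only concerns
    one future time, the law of such a run is obtained by induction on its
    length: the paths with [X (s + g + 1) <> x] are removed, and for those
    [s + g + 1] is a new renewal time, to which (1) applies again. *)
Require Import Defs.
From mathcomp Require Import all_boot all_order all_algebra.
From mathcomp Require Import all_classical all_reals all_analysis.
From mathcomp Require Import ring zify.

Set Implicit Arguments.
Unset Strict Implicit.
Unset Printing Implicit Defensive.

Import Order.TTheory GRing.Theory Num.Theory.

Local Open Scope classical_set_scope.
Local Open Scope ring_scope.

(** * Probabilities as real numbers, and their sums over countable partitions *)

Section real_valued_probability.
Context d (T : measurableType d) (R : realType) (P : probability T R).
Implicit Types A B : set T.

Definition pr A : R := fine (P A).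

Lemma prE A : measurable A -> (pr A)%:E = P A.
Proof. by move=> mA; rewrite /pr fineK// fin_num_measure. Qed.

Lemma pr_ge0 A : 0 <= pr A.
Proof. by rewrite /pr fine_ge0. Qed.

Lemma pr_gt0 A : (0 < P A)%E -> measurable A -> 0 < pr A.
Proof. by move=> + mA; rewrite -prE// lte_fin. Qed.

Lemma pr0 : pr set0 = 0.
Proof. by rewrite /pr measure0. Qed.

Lemma le_pr A B : measurable A -> measurable B -> A `<=` B -> pr A <= pr B.
Proof.
by move=> mA mB AB; rewrite -lee_fin !prE// le_measure// inE.
Qed.

Lemma pr_eq0 A B : measurable A -> measurable B -> A `<=` B -> pr B = 0 ->
  pr A = 0.
Proof.
move=> mA mB AB B0; apply/eqP; rewrite eq_le pr_ge0 andbT -B0; exact: le_pr.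
Qed.

Lemma prDI A B : measurable A -> measurable B ->
  pr A = pr (A `\` B) + pr (A `&` B).
Proof.
move=> mA mB; apply: EFin_inj; rewrite EFinD !prE//.
- exact: measureDI.
- exact: measurableI.
- exact: measurableD.
Qed.

(** Countable additivity over the fibers of [f], indexed by their code under [pickle] because series
    run over [nat]; a code that is not attained contributes an empty fiber. *)
Lemma pr_fibers (C : countType) (f : T -> C) A (a : R) :
  (forall D, measurable (f @^-1` D)) -> measurable A -> 0 <= a ->
  (a * pr A)%:E =
  (\sum_(k <oo) (a * pr (A `&` [set w | pickle (f w) = k]))%:E)%E.
Proof.
move=> mf mA a0.
have mF k : measurable (A `&` [set w | pickle (f w) = k]).
  by apply: measurableI => //; exact: (mf [set c | pickle c = k]).
have tF : trivIset setT (fun k => A `&` [set w | pickle (f w) = k]).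
  apply/trivIsetP => i j _ _ /eqP ij; rewrite -subset0 => w.
  move=> [[_ /= iw] [_ /= jw]].
  by apply: ij; rewrite -iw.
have UF : A = \bigcup_k (A `&` [set w | pickle (f w) = k]).
  apply/seteqP; split => w; last by case=> k _ [].
  by move=> Aw; exists (pickle (f w)).
rewrite EFinM prE// {1}UF measure_semi_bigcup -?UF// -nneseriesZl//.
by apply: eq_eseriesr => k _; rewrite EFinM prE.
Qed.

Lemma pr_fiberwise_eq (C : countType) (f : T -> C) A B (a b : R) :
  (forall D, measurable (f @^-1` D)) -> measurable A -> measurable B ->
  0 <= a -> 0 <= b ->
  (forall w0, a * pr (A `&` f @^-1` [set f w0]) =
              b * pr (B `&` f @^-1` [set f w0])) ->
  a * pr A = b * pr B.
Proof.
move=> mf mA mB a0 b0 ab; apply: EFin_inj; rewrite !(pr_fibers mf)//.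
apply: eq_eseriesr => k _; congr EFin.
have [[w0 w0k]|no] := pselect (exists w0, pickle (f w0) = k).
  suff -> : [set w | pickle (f w) = k] = f @^-1` [set f w0] by [].
  rewrite -w0k; apply/seteqP; split => w /=; last by move=> ->.
  exact: (pcan_inj pickleK).
suff -> : [set w | pickle (f w) = k] = set0 by rewrite !setI0 !pr0 !mulr0.
by rewrite -subset0 => w /= wk; apply: no; exists w.
Qed.

End real_valued_probability.

(** * Events determined by the path up to a given time *)

Section path_events.
Context (T E : Type) (X : nat -> T -> E).
Implicit Types (A B : set T) (t : nat) (w : T).

Definition same_path t w w' := forall k, (k <= t)%N -> X k w = X k w'.

(** For countable [E] these are the events of the sigma-algebra generated by [X 0, ..., X t],
    described as unions of classes of equal paths. *)
Definition path_event t B := forall w w', same_path t w w' -> B w -> B w'.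

Lemma same_path_sym t w w' : same_path t w w' -> same_path t w' w.
Proof. by move=> h k /h. Qed.

Lemma same_pathW s t w w' : (s <= t)%N -> same_path t w w' -> same_path s w w'.
Proof. by move=> st h k ks; apply: h; exact: leq_trans ks st. Qed.

Lemma path_eventW s t B : (s <= t)%N -> path_event s B -> path_event t B.
Proof. by move=> st h w w' /(same_pathW st); exact: h. Qed.

Lemma path_eventI t A B :
  path_event t A -> path_event t B -> path_event t (A `&` B).
Proof. by move=> hA hB w w' e [? ?]; split; [exact: hA e _|exact: hB e _]. Qed.

Lemma path_eventD t A B :
  path_event t A -> path_event t B -> path_event t (A `\` B).
Proof.
move=> hA hB w w' e [? nB]; split; first exact: hA e _.
by move=> /(hB _ _ (same_path_sym e)).
Qed.

Lemma path_event_eq t s (A : set E) : (s <= t)%N ->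
  path_event t [set w | A (X s w)].
Proof. by move=> st w w' /= e; rewrite (e s st). Qed.

Lemma path_event_cylinder t w0 : path_event t (same_path t w0).
Proof. by move=> w w' e h k kt; rewrite h// e. Qed.

Definition history t w : seq E := [seq X k w | k <- iota 0 t.+1].

Lemma historyP t w w' : history t w = history t w' <-> same_path t w w'.
Proof.
split=> [/eq_in_map h k kt|h]; first by apply: h; rewrite mem_iota.
by apply/eq_in_map => k; rewrite mem_iota => /h.
Qed.

End path_events.

Section path_events_measurable.
Context d (T : measurableType d) (E : countType) (X : nat -> T -> E).
Hypothesis hX : discrete_process X.

(** There are countably many sequences, and the fiber of each is empty or a finite intersection of
    events fixing one value of [X]. *)
Lemma measurable_history t (D : set (seq E)) :
  measurable (history X t @^-1` D).
Proof.
pose F c := history X t @^-1` ([set c] `&` D).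
have -> : history X t @^-1` D = \bigcup_c F c.
  by apply/seteqP; split => w /=; [exists (history X t w)|case=> c _ [/= ->]].
apply: countable_bigcupT_measurable; first exact: countableP.
move=> c; rewrite /F; have [Dc|nDc] := pselect (D c); last first.
  suff -> : history X t @^-1` ([set c] `&` D) = set0 by [].
  by rewrite -subset0 => w /= [-> /nDc].
have -> : [set c] `&` D = [set c] by apply/setIidl => ? ->.
have [[w0 <-]|no] := pselect (exists w, history X t w = c); last first.
  suff -> : history X t @^-1` [set c] = set0 by [].
  by rewrite -subset0 => w /= wc; apply: no; exists w.
have -> : history X t @^-1` [set history X t w0] =
    \bigcap_(k in `I_t.+1) X k @^-1` [set X k w0].
  by apply/seteqP; split => w /=; rewrite historyP.
by apply: bigcap_measurable => [|k _]; [exists 0%N|exact: hX].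
Qed.

Lemma path_event_measurable t B : path_event X t B -> measurable B.
Proof.
move=> hB; have -> : B = history X t @^-1` (history X t @` B).
  apply/seteqP; split => w /=; first by exists w.
  by move=> [w' Bw' /historyP e]; exact: hB e Bw'.
exact: measurable_history.
Qed.

End path_events_measurable.

(** * Calculus of conditional independence from the past *)

Section conditional_independence.
Context d (T : measurableType d) (R : realType) (P : probability T R).
Context (E : countType) (X : nat -> T -> E).
Hypothesis hX : discrete_process X.
Implicit Types (A B G : set T) (t : nat).

(* Given [G], the event [A] is independent of [X 0, ..., X t]; clearing the
   denominators makes the property trivial when [G] is negligible. *)
Definition cond_indep t G A := forall B, path_event X t B ->
  pr P (A `&` (G `&` B)) * pr P G = pr P (A `&` G) * pr P (G `&` B).

Lemma cond_indep_ext t G A A' : A `&` G = A' `&` G ->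
  cond_indep t G A -> cond_indep t G A'.
Proof. by move=> e h B /h; rewrite !setIA e. Qed.

Lemma cond_indep_superset t G A : G `<=` A -> cond_indep t G A.
Proof. by move=> GA B _; rewrite setIA !(setIidr GA) mulrC. Qed.

Lemma cond_indep_disjoint t G A : A `&` G = set0 -> cond_indep t G A.
Proof. by move=> AG B _; rewrite setIA AG set0I pr0 !mul0r. Qed.

(** The factor is the conditional probability of [A] given [G]; when [G] is negligible both sides
    vanish. *)
Lemma cond_indep_factor t G A : measurable A -> path_event X t G ->
  cond_indep t G A -> exists r, forall B, path_event X t B -> B `<=` G ->
    pr P (A `&` B) = r * pr P B.
Proof.
move=> mA hG h; exists (pr P (A `&` G) / pr P G) => B hB BG.
have mB := path_event_measurable hX hB.
have mG := path_event_measurable hX hG.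
have [G0|G0] := eqVneq (pr P G) 0.
  have B0 : pr P B = 0 by exact: pr_eq0 BG G0.
  rewrite B0 mulr0; apply: pr_eq0 B0 => //; exact: measurableI.
have := h B hB; rewrite (setIidr BG) => e.
by rewrite mulrAC -e mulfK.
Qed.

(** Inside [B] and [G] the path up to [t'] lies in [G'], so intersecting with [A] multiplies
    probabilities by a constant, and the relation for [B] carries over. *)
Lemma cond_indep_chain t t' G G' A B : (t <= t')%N -> measurable A ->
  path_event X t' G' -> path_event X t' (B `&` G) -> B `&` G `<=` G' ->
  cond_indep t G B -> cond_indep t' G' A -> cond_indep t G (A `&` B).
Proof.
move=> tt' mA hG' hBG BG' hB /(cond_indep_factor mA hG')[r hr] C hC.
have fac D : path_event X t' D ->
    pr P (A `&` (B `&` G `&` D)) = r * pr P (B `&` G `&` D).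
  move=> hD; apply: hr; first exact: path_eventI.
  by move=> w [/BG'].
have := fac _ (path_eventW tt' hC); have := fac setT (fun _ _ _ => id).
rewrite !setIT -!setIA => -> ->.
by rewrite -!mulrA hB.
Qed.

(** For fixed [G] and past event, both sides of the relation are a constant times the probability of
    an event cut by [A], hence countably additive in [A]. *)
Lemma cond_indep_fibers (C : countType) (f : T -> C) t G A :
  (forall D, measurable (f @^-1` D)) -> measurable A -> path_event X t G ->
  (forall w0, cond_indep t G (A `&` f @^-1` [set f w0])) -> cond_indep t G A.
Proof.
move=> mf mA hG h B hB.
have mG := path_event_measurable hX hG.
have mB := path_event_measurable hX hB.
rewrite mulrC [RHS]mulrC.
apply: (pr_fiberwise_eq mf) => //; do ?[exact: measurableI|exact: pr_ge0].
  by apply: measurableI => //; exact: measurableI.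
move=> w0; have := h w0 B hB.
by rewrite mulrC [RHS]mulrC setIAC => ->; rewrite setIAC.
Qed.

Lemma cond_indepD t G A A' : measurable A -> measurable A' ->
  path_event X t G ->
  cond_indep t G A -> cond_indep t G (A `&` A') -> cond_indep t G (A `\` A').
Proof.
move=> mA mA' hG h h' B hB.
have mG := path_event_measurable hX hG.
have mB := path_event_measurable hX hB.
have split C : measurable C ->
    pr P ((A `\` A') `&` C) = pr P (A `&` C) - pr P (A `&` A' `&` C).
  move=> mC; rewrite (prDI P (measurableI _ _ mA mC) mA').
  have -> : (A `&` C) `\` A' = (A `\` A') `&` C by rewrite !setDE setIAC.
  by rewrite (setIAC A C) addrK.
by rewrite !split ?mulrBl ?h ?h'//; exact: measurableI.
Qed.

(** Every past event is a countable union of cylinders, so the relation may be checked path by path.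
    This is the link with (1) and (2), which condition on a full path of positive probability. *)
Lemma cond_indep_cylinders t G A : measurable A -> path_event X t G ->
  (forall w0, G w0 -> (0 < P (same_path X t w0))%E ->
    pr P (A `&` same_path X t w0) * pr P G =
    pr P (A `&` G) * pr P (same_path X t w0)) ->
  cond_indep t G A.
Proof.
move=> mA hG h B hB.
have mG := path_event_measurable hX hG.
have mB := path_event_measurable hX hB.
have mc w0 := path_event_measurable hX (@path_event_cylinder _ _ X t w0).
rewrite mulrC.
apply: (pr_fiberwise_eq (@measurable_history _ _ _ _ hX t)) => //;
  do ?[exact: measurableI|exact: pr_ge0].
  by apply: measurableI => //; exact: measurableI.
move=> w0.
have -> : history X t @^-1` [set history X t w0] = same_path X t w0.
  apply/seteqP; split => w /=; rewrite historyP; exact: same_path_sym.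
rewrite -setIA.
have [GB|nGB] := pselect ((G `&` B) w0); last first.
  suff -> : G `&` B `&` same_path X t w0 = set0 by rewrite setI0 pr0 !mulr0.
  rewrite -subset0 => w [GBw e]; apply: nGB.
  exact: path_eventI (same_path_sym e) GBw.
have -> : G `&` B `&` same_path X t w0 = same_path X t w0.
  by apply/setIidr => w e; exact: path_eventI e GB.
have [c0|] := eqVneq (P (same_path X t w0)) 0%E; last first.
  move=> c0; rewrite mulrC; apply: h; first by case: GB.
  by rewrite lt0e c0 measure_ge0.
have c0' : pr P (same_path X t w0) = 0 by rewrite /pr c0.
rewrite c0' mulr0.
rewrite [X in _ * X](_ : _ = 0) ?mulr0//.
by apply: pr_eq0 c0' => //; exact: measurableI.
Qed.

End conditional_independence.

(** * The sojourn time as the time elapsed since the last renewal *)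

Section sojourn_time.
Context (T : Type) (E : eqType) (X : nat -> T -> E).
Implicit Types (s t g : nat) (w : T).

Definition constant_since_renewal s g w (x : E) :=
  renewal_set X w s /\ forall j, (j <= g)%N -> X (s + j)%N w = x.

Lemma sojourn_le t w : (sojourn X t w <= t)%N.
Proof. by apply/bigmax_leqP => i _; rewrite -ltnS. Qed.

(** The maximum is attained, since the index 0 is admissible, and its maximality forces a change of
    value at the start of the stretch unless that start is time 0. *)
Lemma sojourn_constant t w :
  constant_since_renewal (t - sojourn X t w) (sojourn X t w) w (X t w).
Proof.
pose p (i : 'I_t.+1) := [forall j : 'I_i.+1, X t w == X (t - j)%N w].
have p0 : (0 < #|p|)%N.
  apply/card_gt0P; exists ord0; rewrite unfold_in; apply/forallP => j.
  by rewrite ord1 subn0.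
have [i /forallP pi si] := @eq_bigmax_cond _ p val p0.
have {}si : sojourn X t w = i by exact: si.
have it : (i <= t)%N by rewrite -ltnS.
rewrite si; split; last first.
  move=> j ji; have ij : (i - j < i.+1)%N by rewrite ltnS leq_subr.
  have /eqP -> := pi (Ordinal ij).
  by congr (X _ w) => /=; lia.
have [/eqP ti0|ti0] := boolP (t - i == 0)%N; [by left|right].
(* Without a change of value at [t - i], the index [i.+1] would be admissible too. *)
rewrite lt0n; split => // e.
have it1 : (i.+1 < t.+1)%N by rewrite ltnS -subn_gt0 lt0n.
suff pi1 : p (Ordinal it1).
  by have := @leq_bigmax_cond _ p val _ pi1; rewrite [X in (_ <= X)%N]si ltnn.
apply/forallP => -[j /=]; rewrite ltnS leq_eqVlt => /predU1P[->|ji].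
  by rewrite subnS e; exact: (pi ord_max).
exact: (pi (Ordinal ji)).
Qed.

(** If [s < s'], then [s'.-1] and [s'] both lie in the stretch starting at [s], where [X] is
    constant, so [s'] is not a renewal time. *)
Lemma constant_since_renewal_inj s s' g g' w x y :
  constant_since_renewal s g w x -> constant_since_renewal s' g' w y ->
  (s + g = s' + g')%N -> s = s'.
Proof.
wlog ss' : s s' g g' x y / (s <= s')%N => [h H H' e|].
  by have /orP[ss'|ss'] := leq_total s s'; [|symmetry];
    apply: h ss' _ _ _; eassumption || exact/esym.
move=> [_ h] [[s'0|[s'0 r]] _] e.
  by move: ss'; rewrite s'0 leqn0 => /eqP.
apply/eqP; rewrite eqn_leq ss'/= leqNgt; apply/negP => lt; apply: r.
have E1 : s'.-1 = (s + (s'.-1 - s))%N by rewrite subnKC// -ltnS prednK.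
have E2 : s' = (s + (s' - s))%N by rewrite subnKC// ltnW.
by rewrite E1 [in RHS]E2 !h//; lia.
Qed.

Lemma sojournP s g w x :
  (X (s + g)%N w, sojourn X (s + g)%N w) = (x, g) <->
  constant_since_renewal s g w x.
Proof.
have c := sojourn_constant (s + g) w.
split=> [[ex eg]|c']; first by move: c; rewrite eg addnK ex.
have e : (s + g - sojourn X (s + g) w + sojourn X (s + g) w = s + g)%N.
  by rewrite subnK// sojourn_le.
rewrite (c'.2 g)//; congr pair.
by have := constant_since_renewal_inj c c' e; move: e => /[swap] ->; lia.
Qed.

(** Each case exhibits the stretch ending at [t.+1]: the old one prolonged, or a new one starting
    there. *)
Lemma sojournS t w :
  sojourn X t.+1 w = if X t.+1 w == X t w then (sojourn X t w).+1 else 0%N.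
Proof.
case: ifPn => [/eqP e|/eqP e].
  have [r c] := sojourn_constant t w; have le := sojourn_le t w.
  have E1 : t.+1 = (t - sojourn X t w + (sojourn X t w).+1)%N.
    by rewrite addnS subnK.
  suff /sojournP : constant_since_renewal (t - sojourn X t w)
    (sojourn X t w).+1 w (X t w) by rewrite -E1 => -[_ ->].
  split=> // j; rewrite leq_eqVlt => /predU1P[->|]; first by rewrite -E1.
  exact: c.
suff /sojournP : constant_since_renewal t.+1 0 w (X t.+1 w).
  by rewrite addn0 => -[].
split; last by move=> j; rewrite leqn0 => /eqP ->; rewrite addn0.
by right; split => // /esym.
Qed.

End sojourn_time.

(** * Runs and states as events of the past *)

Section sojourn_events.
Context (T : Type) (E : eqType) (X : nat -> T -> E).

Definition run s g (x : E) : set T :=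
  [set w | constant_since_renewal X s g w x].

Definition state t (w : T) : E * nat := (X t w, sojourn X t w).

Lemma state_run s g x : state (s + g) @^-1` [set (x, g)] = run s g x.
Proof. by apply/seteqP; split => w /sojournP. Qed.

Lemma run_decr s g g' x : (g' <= g)%N -> run s g x `<=` run s g' x.
Proof. by move=> gg' w [r h]; split => // j /leq_trans/(_ gg'); exact: h. Qed.

Lemma runS s g x :
  run s g.+1 x = run s g x `&` [set w | X (s + g).+1 w = x].
Proof.
apply/seteqP; split => w [].
  by move=> r h; split; [split=> // j jg; apply: h; lia|rewrite /= -addnS h].
move=> [r h] /= h'; split=> // j; rewrite leq_eqVlt => /predU1P[->|].
  by rewrite addnS.
exact: h.
Qed.

Lemma path_event_renewal s : path_event X s [set w | renewal_set X w s].
Proof.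
move=> w w' e /= [->|[s0 r]]; [by left|right].
by rewrite -(e s)// -(e s.-1)// leq_pred.
Qed.

Lemma path_event_run s g x : path_event X (s + g) (run s g x).
Proof.
move=> w w' e [r h]; split; last by move=> j jg; rewrite -e ?h// leq_add2l.
by apply: path_event_renewal r; apply: same_pathW e; exact: leq_addr.
Qed.

Lemma state_same_path t w w' : same_path X t w w' -> state t w = state t w'.
Proof.
move=> e; rewrite /state e//; congr pair; apply: eq_bigl => i.
by apply: eq_forallb => j; rewrite !e// leq_subr.
Qed.

Lemma path_event_state t D : path_event X t (state t @^-1` D).
Proof. by move=> w w' /state_same_path /= ->. Qed.

(** Given the state at [t], the next value of [X] dictates the next sojourn time; any other [g']
    makes the event empty. *)
Lemma state_step t (x z : E) g g' :
  state t.+1 @^-1` [set (z, g')] `&` state t @^-1` [set (x, g)] =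
  (if g' == (if z == x then g.+1 else 0%N) then [set w | X t.+1 w = z]
   else set0)
    `&` state t @^-1` [set (x, g)].
Proof.
apply/seteqP; split => w [].
  move=> + [ex eg]; rewrite /state /= sojournS ex eg => -[ez <-].
  by rewrite ez eqxx.
case: eqP => [-> /= ez [ex eg]|_ []//].
by rewrite /state /= sojournS ez ex eg.
Qed.

End sojourn_events.

(** * The natural filtration and the renewal events *)

Section natural_filtration.
Context d (T : measurableType d) (E : countType) (X : nat -> T -> E).

(** Path events form a sigma-algebra containing the generators. *)
Lemma natural_filtration_path_event t B :
  natural_filtration X t B -> path_event X t B.
Proof.
move=> /(_ (path_event X t)); apply; split.
  split; first by move=> w w' _ [].
    by move=> A hA; apply: path_eventD => // w w'.
  by move=> F hF w w' e [k _ Fk]; exists k => //; exact: hF e Fk.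
by move=> _ [s [A [st ->]]]; exact: path_event_eq.
Qed.

Lemma natural_filtration_renewal s t : (s <= t)%N ->
  natural_filtration X t [set w | renewal_set X w s].
Proof.
move=> st; pose G := [set B : set T |
  exists u (A : set E), (u <= t)%N /\ B = X u @^-1` A].
have mX (u : nat) (A : set E) : (u <= t)%N ->
    measurable (X u @^-1` A : set (g_sigma_algebraType G)).
  by move=> ut; apply: sub_sigma_algebra; exists u, A.
suff : measurable ([set w | renewal_set X w s] : set (g_sigma_algebraType G)).
  by [].
have [->|s0] := eqVneq s 0%N.
  have -> : [set w | renewal_set X w 0] = setT.
    by apply/seteqP; split => w // _; left.
  exact: measurableT.
(* Splitting on the value at time [s] gives a countable union of intersections of generators. *)
have -> : [set w | renewal_set X w s] =
    \bigcup_(e : E) (X s @^-1` [set e] `&` X s.-1 @^-1` ~` [set e]).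
  apply/seteqP; split => w /=.
    by move=> [/eqP|[_ r]]; [rewrite (negbTE s0)|exists (X s w)].
  by move=> [e _ [/= se ne]]; right; rewrite lt0n se.
apply: countable_bigcupT_measurable; first exact: countableP.
move=> e; apply: measurableI; apply: mX => //.
exact: leq_trans (leq_pred _) st.
Qed.

End natural_filtration.

(** * The two implications between (1) and (2) *)

Section semi_markov_equivalence.
Context d (T : measurableType d) (R : realType) (P : probability T R).
Context (E : countType) (X : nat -> T -> E).
Hypothesis hX : discrete_process X.

Lemma measurable_state t D : measurable (state X t @^-1` D).
Proof. exact (path_event_measurable hX (@path_event_state _ _ X t D)). Qed.

Lemma cond_prob_eq A B C : (0 < P B)%E -> measurable B -> measurable C ->
  B `<=` C ->
  cond_prob P A B = cond_prob P A C <->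
  pr P (A `&` B) * pr P C = pr P (A `&` C) * pr P B.
Proof.
move=> B0 mB mC BC.
have cpE D : cond_prob P A D = pr P (A `&` D) / pr P D by [].
rewrite !cpE.
have pB := pr_gt0 B0 mB; have pC := lt_le_trans pB (le_pr P mB mC BC).
have nB := lt0r_neq0 pB; have nC := lt0r_neq0 pC.
by split=> /eqP e; apply/eqP; move: e; rewrite (eqr_div _ _ nB nC).
Qed.

Lemma shifted_eventE (tau : T -> option nat) n (x : E) t B :
  B `<=` [set w | tau w = Some t] ->
  shifted_event X tau n x `&` B = [set w | X (t + n)%N w = x] `&` B.
Proof.
move=> Bt; apply/seteqP; split => w [+ Bw]; have tw := Bt w Bw; last first.
  by move=> Xx; split => //; exists t.
by rewrite /shifted_event /= tw => -[u [<-]].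
Qed.

(** Property (1) is applied to the Markov time equal to [s] when [s] is a renewal time and infinite
    otherwise; it gives the relation cylinder by cylinder. *)
Lemma cond_indep_semi_markov (s n : nat) (x z : E) :
  semi_markov P (natural_filtration X) X ->
  cond_indep P X s (run X s 0 x) [set w | X (s + n)%N w = z].
Proof.
move=> sm; case: n => [|n].
  (* Property (1) only concerns positive shifts; for shift 0 the event is decided by [X s = x]. *)
  have [<-|xz] := eqVneq x z.
    by apply: cond_indep_superset => w [_]; exact.
  apply: cond_indep_disjoint; rewrite -subset0 => w [/= Xz [_ h]].
  by move: xz; rewrite -(h 0%N)// Xz eqxx.
pose tau w := if `[< renewal_set X w s >] then Some s else None.
have tauE w t : tau w = Some t <-> renewal_set X w s /\ s = t.
  by rewrite /tau; case: asboolP => h; split;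
    by [case=> ->|case=> _ ->|move=> //|case].
have markov_tau : markov_time (natural_filtration X) tau.
  move=> t; have [st|ts] := leqP s t.
    have -> : [set w | exists2 u, tau w = Some u & (u <= t)%N] =
        [set w | renewal_set X w s].
      apply/seteqP; split => w /=; first by case=> u /tauE[].
      by exists s => //; apply/tauE.
    exact: natural_filtration_renewal.
  have -> : [set w | exists2 u, tau w = Some u & (u <= t)%N] = set0.
    rewrite -subset0 => w /= [u /tauE[_ <-]].
    by rewrite leqNgt ts.
  exact: sigma_algebra0.
have tau_renewal : valued_in P tau (renewal_set X).
  rewrite /valued_in -[RHS](probability_setT P); congr (P _).
  by apply/seteqP; split => w //= _ t /tauE[+ <-].
have hG := @path_event_run _ _ X s 0 x; rewrite addn0 in hG.
apply: cond_indep_cylinders => //.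
  exact: (hX (s + n.+1) [set z]).
move=> w0 Gw0.
have pastE : same_path X s w0 = [set w | tau w = Some s /\
    forall k, (k <= s)%N -> X k w = X k w0].
  apply/seteqP; split => w /= e; last by move=> k ks; rewrite e.2.
  split; last by move=> k ks; rewrite e.
  by apply/tauE; split => //; exact: path_event_renewal e Gw0.1.
have presentE : run X s 0 x = [set w | tau w = Some s /\ X s w = X s w0].
  have Xx w : run X s 0 x w -> X s w = x.
    by case=> _ /(_ 0%N); rewrite addn0 => ->.
  apply/seteqP; split => w /=.
    by move=> Gw; rewrite !Xx//; split=> //; apply/tauE; split => //; case: Gw.
  move=> [/tauE[r _] e]; split => // j; rewrite leqn0 => /eqP ->.
  by rewrite addn0 e; exact: Xx.
have mpast := path_event_measurable hX (@path_event_cylinder _ _ X s w0).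
have mpresent := path_event_measurable hX hG.
rewrite pastE presentE in mpast mpresent * => past0.
have := sm tau markov_tau tau_renewal n.+1 z s (X^~ w0) isT past0.
rewrite cond_prob_eq//; last by move=> w [? /(_ s (leqnn s))].
by rewrite !(@shifted_eventE _ _ _ s)// => w [].
Qed.

(** Induction on [g], for all [m] and [z] at once, because the step uses the hypothesis at [m.+1]
    and at 1. *)
Lemma cond_indep_semi_markov_run (s g m : nat) (x z : E) :
  semi_markov P (natural_filtration X) X ->
  cond_indep P X s (run X s 0 x)
    (run X s g x `&` [set w | X (s + g + m)%N w = z]).
Proof.
move=> sm.
have mrun u h y := path_event_measurable hX (@path_event_run _ _ X u h y).
have mX k (A : set E) : measurable [set w | A (X k w)] by exact: (hX k A).
have hG u y := @path_event_run _ _ X u 0 y.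
elim: g m z => [|g IH] m z.
  apply: (cond_indep_ext _ (@cond_indep_semi_markov s m x z sm)).
  by rewrite addn0 (setIC (run _ _ _ _)) -setIA setIid.
(* The longer run is the shorter one minus the paths that leave [x] at time [s + g + 1]. *)
have -> : run X s g.+1 x `&` [set w | X (s + g.+1 + m)%N w = z] =
    (run X s g x `&` [set w | X (s + g + m.+1)%N w = z]) `\`
    [set w | X (s + g).+1 w <> x].
  rewrite runS setDE setIAC addnS addSnnS; congr (_ `&` _).
  by apply/seteqP; split => w /=; [move=> ? h; exact: h|exact: contrapT].
have hG0 : path_event X s (run X s 0 x) by rewrite -{1}(addn0 s).
have mA k : measurable (run X s g x `&` [set w | X k w = z]).
  by apply: measurableI => //; exact: (mX _ [set z]).
have mA' : measurable [set w | X (s + g).+1 w <> x].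
  exact: (mX _ [set y | y <> x]).
apply: cond_indepD => //.
(* The removed event is split by the value of [X] at time [s + g + 1]; the fiber over [x] is
   empty. *)
apply: (@cond_indep_fibers _ _ _ _ _ _ hX _ (X (s + g).+1)) => //.
  exact: measurableI.
move=> w0; have [ex|ex] := eqVneq (X (s + g).+1 w0) x.
  apply: cond_indep_disjoint; rewrite -subset0 => w [[[_ /= nx] e] _].
  by apply: nx; rewrite e.
pose e := X (s + g).+1 w0.
apply: (@cond_indep_ext _ _ _ _ _ _ _ _
  ([set w | X ((s + g).+1 + m)%N w = z] `&`
   (run X s g x `&` [set w | X (s + g + 1)%N w = e]))).
  congr (_ `&` _); rewrite addSnnS addn1.
  apply/seteqP; split => w /=; first by move=> [? [? E1]]; rewrite E1; split;
    [split=> //; exact/eqP|].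
  by move=> [[[? ?] ?] ?].
have hB : path_event X (s + g).+1
    (run X s g x `&` [set w | X (s + g + 1)%N w = e] `&` run X s 0 x).
  apply: path_eventI; last by apply: (path_eventW _ hG0); lia.
  apply: path_eventI.
    exact: (path_eventW (leqnSn _) (@path_event_run _ _ X s g x)).
  by apply: (@path_event_eq _ _ _ _ _ [set e]); rewrite addn1.
(* The induction hypothesis with [m = 1] treats the run ended by a jump to [e]; then [(s + g).+1] is
   a renewal time with value [e]. *)
apply: (cond_indep_chain hX _ _ _ hB _ (IH 1%N e)
  (@cond_indep_semi_markov (s + g).+1 m e z sm)).
- by lia.
- exact: (mX _ [set z]).
- by rewrite -{1}(addn0 (s + g).+1).
move=> w [[[r h] /= Xe] _]; rewrite addn1 in Xe.
split; last by move=> j; rewrite leqn0 => /eqP ->; rewrite addn0.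
by right; split => //=; rewrite Xe h// => /esym/eqP; apply/negP.
Qed.

(** Dividing the instance [m = 1] of [cond_indep_semi_markov_run] by the instance [m = 0], the run
    itself, changes the conditioning from the start of the run to the whole run. *)
Lemma cond_indep_run_next (s g : nat) (x z : E) :
  semi_markov P (natural_filtration X) X ->
  cond_indep P X (s + g) (run X s g x) [set w | X (s + g).+1 w = z].
Proof.
move=> sm B hB.
set A := [set w | _]; set S := run X s g x.
have mS : measurable S :=
  path_event_measurable hX (@path_event_run _ _ X s g x).
have mA : measurable A := hX (s + g).+1 [set z].
pose J := run X s 0 x.
have hJ : path_event X s J.
  by have := @path_event_run _ _ X s 0 x; rewrite addn0.
have mJ := path_event_measurable hX hJ.
have SJ : S `<=` J by exact: run_decr.
(* On [S] the path up to [s + g] is determined by the path up to [s]. *)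
pose D := [set w | exists w', same_path X s w w' /\ (S `&` B) w'].
have hD : path_event X s D.
  move=> w w' e [v [ev Sv]]; exists v; split => // k ks.
  by rewrite -e// ev.
have mD := path_event_measurable hX hD.
have -> : S `&` B = S `&` D.
  apply/seteqP; split=> w [Sw]; first by move=> Bw; split=> //; exists w; split.
  move=> [w' [e [Sw' Bw']]]; split => //; apply: hB Bw' => k ksg.
  have [ks|sk] := leqP k s; first by rewrite e.
  have -> : k = (s + (k - s))%N by rewrite subnKC// ltnW.
  by rewrite Sw.2 ?Sw'.2//; lia.
have eA : pr P (A `&` (S `&` D)) * pr P J = pr P (A `&` S) * pr P (J `&` D).
  have := @cond_indep_semi_markov_run s g 1 x z sm D hD.
  rewrite addn1 -/A -/S -/J (setIC S A) -setIA.
  rewrite [S `&` (J `&` D)]setIA (setIidl SJ).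
  by rewrite -(setIA A) (setIidl SJ).
have eS : pr P (S `&` D) * pr P J = pr P S * pr P (J `&` D).
  have := @cond_indep_semi_markov_run s g 0 x x sm D hD.
  rewrite addn0 (_ : run X s g x `&` _ = S); last first.
    by apply/setIidl => w [_]; exact.
  by rewrite -/J setIA (setIidl SJ).
have [J0|J0] := eqVneq (pr P J) 0.
  have S0 : pr P S = 0 by exact: pr_eq0 SJ J0.
  rewrite S0 mulr0 (_ : pr P (A `&` S) = 0) ?mul0r//.
  by apply: pr_eq0 S0 => //; exact: measurableI.
apply: (mulIf J0); rewrite mulrAC eA -[RHS]mulrA eS; ring.
Qed.

(** A state [(x, g)] at time [t] is a run started at [t - g], and [state_step] turns the relation
    for the next value of [X] into one for the next state. *)
Lemma semi_markov_markov :
  semi_markov P (natural_filtration X) X -> markov_process P (state X).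
Proof.
move=> sm [//|t] y _ /= past0.
pose G := state X t @^-1` [set y t].
have hG : path_event X t G by exact: path_event_state.
pose past := [set w | forall k, (k < t.+1)%N -> state X k w = y k].
have hpast : path_event X t past.
  by move=> w w' e h k kt; rewrite -h//; symmetry;
    apply: state_same_path; exact: same_pathW e.
apply/cond_prob_eq => //.
- exact: (path_event_measurable hX hpast).
- exact: (path_event_measurable hX hG).
- by move=> w; apply.
have : cond_indep P X t G (state X t.+1 @^-1` [set y t.+1]).
  move: @G hG; case: (y t) => x g; case: (y t.+1) => z g' G hG.
  (* For [g > t] the state is never attained, and [t - g] would be truncated. *)
  have [gt|tg] := leqP g t; last first.
    apply: cond_indep_disjoint; rewrite -subset0 => w [_ [_ sg]].
    by have := sojourn_le X t w; rewrite sg leqNgt tg.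
  apply: (cond_indep_ext (esym (state_step _ _ _ _ _ _))).
  case: ifP => _; last by apply: cond_indep_disjoint; rewrite set0I.
  have := @cond_indep_run_next (t - g) g x z sm.
  by rewrite -state_run subnK.
move=> /(_ _ hpast); rewrite (_ : G `&` past = past)//.
by apply/setIidr => w; exact.
Qed.

(** The path of [X] and the path of states up to [t] determine each other, so both formulations have
    the same past. *)
Lemma cond_indep_markov t (y y' : E * nat) : markov_process P (state X) ->
  cond_indep P X t (state X t @^-1` [set y]) (state X t.+1 @^-1` [set y']).
Proof.
move=> mk; apply: cond_indep_cylinders => //; first exact: measurable_state.
  exact: path_event_state.
move=> w0 Gw0.
(* Property (2) takes a single sequence of states: it follows [w0] up to [t], then takes the target
   value [y']. *)
pose v k := if (k <= t)%N then state X k w0 else y'.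
have cE : same_path X t w0 =
    [set w | forall k, (k < t.+1)%N -> state X k w = v k].
  apply/seteqP; split => w h k kt; rewrite /v.
    by have := kt; rewrite ltnS => kt'; rewrite kt'; symmetry;
       apply: state_same_path; exact: same_pathW h.
  by have := h k kt; rewrite /v kt => -[].
have mc := path_event_measurable hX (@path_event_cylinder _ _ X t w0).
rewrite cE in mc * => c0.
have := mk t.+1 v isT c0.
rewrite /= cond_prob_eq//; last 2 first.
  exact: (measurable_state t [set v t]).
  by move=> w; exact.
by rewrite /v leqnn ltnn Gw0.
Qed.

(** Induction on [n]: the event is split by the state at [t.+1], and the one-step relation is
    chained with the induction hypothesis from that state. *)
Lemma cond_indep_markov_shift t n (y : E * nat) (z : E) :
  markov_process P (state X) ->
  cond_indep P X t (state X t @^-1` [set y]) [set w | X (t + n)%N w = z].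
Proof.
move=> mk; elim: n t y => [|n IH] t y.
  rewrite addn0; have [<-|yz] := eqVneq y.1 z.
    by apply: cond_indep_superset => w /= <-.
  apply: cond_indep_disjoint; rewrite -subset0 => w [/= Xz e].
  by move: yz; rewrite -e /= Xz eqxx.
rewrite addnS -addSn.
apply: (cond_indep_fibers hX (measurable_state t.+1)) => //.
- exact: (hX _ [set z]).
- exact: path_event_state.
move=> w0; apply: (cond_indep_chain hX _ _ _ _ _ _ (IH t.+1 (state X t.+1 w0))).
- exact: leqnSn.
- exact: (hX _ [set z]).
- exact: path_event_state.
- apply: path_eventI; first exact: path_event_state.
  exact: (path_eventW (leqnSn t) (@path_event_state _ _ X t _)).
- exact: subIsetl.
- exact: cond_indep_markov.
Qed.

(** Where [tau = t], the time [t] is almost surely a renewal time, so up to a null set [past] and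
    [present] lie in [G], where the future event has one and the same factor [r]. *)
Lemma markov_semi_markov :
  markov_process P (state X) -> semi_markov P (natural_filtration X) X.
Proof.
move=> mk tau htau tauM n x t y _ past present past0.
(* Sojourn time 0 encodes that [t] is a renewal time. *)
pose G := state X t @^-1` [set (y t, 0%N)].
pose J := [set w | renewal_set X w t].
have htau' s : path_event X s [set w | tau w = Some s].
  have -> : [set w | tau w = Some s] =
      [set w | exists2 u, tau w = Some u & (u <= s)%N] `\`
      [set w | exists2 u, tau w = Some u & (u < s)%N].
    apply/seteqP; split => w /=.
      by move=> e; split; [exists s|case=> u; rewrite e => -[->]; rewrite ltnn].
    move=> [[u e us] h]; rewrite e; congr Some; apply/eqP.
    by rewrite eqn_leq us leqNgt; apply/negP => us'; apply: h; exists u.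
  apply: path_eventD; first exact: natural_filtration_path_event (htau s).
  (* No time precedes 0, so the subtracted event is empty there. *)
  case: s => [|s]; first by move=> w w' _ [].
  apply: (path_eventW (leqnSn s)).
  exact: natural_filtration_path_event (htau s).
(* The values of [tau] are renewal times only almost surely, so restricting to [J] discards a null
   set. *)
have null B : measurable B -> B `<=` [set w | tau w = Some t] ->
    pr P B = pr P (J `&` B).
  move=> mB Bt.
  have mJ : measurable J.
    exact (path_event_measurable hX (@path_event_renewal _ _ X t)).
  rewrite (prDI P mB mJ) setIC (_ : pr P (B `\` J) = 0) ?add0r//.
  pose N := [set w | forall t, tau w = Some t -> renewal_set X w t].
  have mN : measurable N.
    have -> : N = \bigcap_s ~` ([set w | tau w = Some s] `\`
                               [set w | renewal_set X w s]).
      apply/seteqP; split => w /=; first by move=> h s _ [/h].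
      by move=> h s e; apply: contrapT => nr; exact: (h s).
    apply: bigcapT_measurable => s; apply: measurableC.
    apply: (path_event_measurable hX (t := s)).
    by apply: path_eventD => //; exact: path_event_renewal.
  have N0 : pr P (~` N) = 0 by rewrite /pr probability_setC// tauM subee.
  apply: pr_eq0 N0; [exact: measurableD|exact: measurableC|].
  by move=> w [/Bt e nJ] h; apply: nJ; exact: h.
have hG : path_event X t G by exact: path_event_state.
have GE : G = J `&` [set w | X t w = y t].
  have := state_run X t 0 (y t); rewrite addn0 -/G => ->.
  apply/seteqP; split => w [r h]; split => //.
    by have := h 0%N; rewrite addn0; exact.
  by move=> j; rewrite leqn0 => /eqP ->; rewrite addn0.
have hpresent : path_event X t present.
  apply: path_eventI; [exact: htau'|].
  exact: (@path_event_eq _ _ _ _ _ [set y t]).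
have hpast : path_event X t past.
  apply: path_eventI; first exact: htau'.
  by move=> w w' e h k kt; rewrite -e// h.
have mpast := path_event_measurable hX hpast.
have mpresent := path_event_measurable hX hpresent.
have pp : past `<=` present by move=> w [? h]; split => //; exact: h.
apply/cond_prob_eq => //.
have mA : measurable [set w | X (t + n)%N w = x] := hX (t + n)%N [set x].
have [r hr] := cond_indep_factor hX mA hG
  (@cond_indep_markov_shift t n (y t, 0%N) x mk).
have factor B : path_event X t B -> B `<=` present ->
    pr P (shifted_event X tau n x `&` B) = r * pr P B.
  move=> hB Bp; have mB := path_event_measurable hX hB.
  rewrite (@shifted_eventE _ _ _ t); last by move=> w /Bp[].
  rewrite null; [|exact: measurableI|by move=> w [_ /Bp[]]].
  rewrite [in RHS]null//; last by move=> w /Bp[].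
  rewrite setICA hr//.
    by apply: path_eventI => //; exact: path_event_renewal.
  by rewrite GE => w [? /Bp[]].
by rewrite !factor// mulrAC.
Qed.

End semi_markov_equivalence.

Theorem theorem2p2 (d : measure_display) (T : measurableType d) (R : realType)
    (P : probability T R) (E : countType) (X : nat -> T -> E)
    (hX : discrete_process X) :
  semi_markov P (natural_filtration X) X <->
  markov_process P (fun t w => (X t w, sojourn X t w)).
Proof.
split; [exact: semi_markov_markov|exact: markov_semi_markov].
Qed.
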